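(* Let $\Omega_k=B(0,k)$ for $k\in\mathbb{N}$ and $\Omega=\bigcup_{k\in\mathbb{N}}B(0,k)=\mathbb{R}^n$. Let $H(x,p)=a(x)K(p)$ for $(x,p)\in\mathbb{R}^n\times\mathbb{R}^n$, where $K:\mathbb{R}^n\to\mathbb{R}$ satisfies $K(0)=0$ and is locally Lipschitz and coercive in $\mathbb{R}^n$ ($K(p)\to+\infty$ as $|p|\to\infty$), and $a\in\mathrm{BUC}(\mathbb{R}^n)$ satisfies $\alpha\le a(\cdot)\le\beta$ for some given $\alpha,\beta>0$. For $k\in\mathbb{N}$ let $u_k$ be the unique state-constraint viscosity solution of $u_k(x)+H(x,Du_k(x))=0$ in $B(0,k)$, and let $u$ be the unique state-constraint viscosity solution of $u(x)+H(x,Du(x))=0$ in $\mathbb{R}^n$. Then $u\equiv 0$, and for every $x\in\overline{B(0,k)}$, $$0\le u_k(x)\le \left(Ce^{\frac{|x|}{C}}\right)e^{-\frac{k}{C}},$$ where $C$ is a constant depending only on $H$. In particular, for any fixed $R>0$, $$0\le u_k(x)\le \left(Ce^{\frac{R}{C}}\right)e^{-\frac{k}{C}}\qquad\text{for every }x\in\overline{B(0,R)}\text{ and }k\ge R.$$ In addition to that, this exponential rate is optimal.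
   Context: $\mathbb{N}=\{1,2,\dots\}$; $B(0,r)$ is the open ball of radius $r$ centered at $0$ in $\mathbb{R}^n$. BUC denotes bounded uniformly continuous functions. For an open set $\Omega\subset\mathbb{R}^n$ and a continuous $H$: $v\in \mathrm{BUC}(\Omega;\mathbb{R})$ is a viscosity subsolution of $v+H(x,Dv)=0$ in $\Omega$ if for every $x\in\Omega$ and $\varphi\in C^1(\Omega)$ such that $v-\varphi$ has a local maximum over $\Omega$ at $x$, $v(x)+H(x,D\varphi(x))\le 0$. $v\in \mathrm{BUC}(\overline\Omega;\mathbb{R})$ is a viscosity supersolution on $\overline\Omega$ if for every $x\in\overline\Omega$ and $\varphi\in C^1(\overline\Omega)$ such that $v-\varphi$ has a local minimum over $\overline\Omega$ at $x$, $v(x)+H(x,D\varphi(x))\ge 0$. A state-constraint viscosity solution in $\Omega$ is a function that is both a viscosity subsolution in $\Omega$ and a viscosity supersolution on $\overline\Omega$. For $\Omega=\mathbb{R}^n$ this is the usual notion of viscosity solution in $\mathrm{BUC}(\mathbb{R}^n)$. Under the hypotheses of the claim, such solutions exist and are unique. *)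

(* Defs.v *)
From HB Require Import structures.
From mathcomp Require Import all_boot all_order all_algebra.
From mathcomp Require Import all_classical all_reals all_analysis.

Set Implicit Arguments.
Unset Strict Implicit.
Unset Printing Implicit Defensive.

Import Order.TTheory GRing.Theory Num.Theory.
Import numFieldNormedType.Exports.

Local Open Scope classical_set_scope.
Local Open Scope ring_scope.

Section definitions.
Context {R : realType} {n : nat}.
Local Notation E := 'rV[R]_n.

(* The library norm `|x| on row vectors is the sup norm.  It induces the usual
   topology and uniformity, but balls and |x| have to be Euclidean. *)
Definition enorm (x : E) : R := Num.sqrt (\sum_(i < n) x 0 i ^+ 2).

Definition eball (r : R) : set E := [set x | enorm x < r].

(* [subspace A] carries the uniformity of A (points outside A are isolated), so
   this constrains only the restriction of v to A. *)
Definition BUC (A : set E) (v : E -> R) : Prop :=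
  [bounded v x | x in A] /\ unif_continuous (v : subspace A -> R).

Definition grad (phi : E -> R) (x : E) : E :=
  \row_(i < n) 'D_(delta_mx 0 i) phi x.

(* To be used with U open. *)
Definition C1_on (U : set E) (phi : E -> R) : Prop :=
  forall x, U x -> differentiable phi x /\ {for x, continuous (grad phi)}.

(* C^1 up to the boundary: C^1 on some open neighbourhood of [closure Omega]. *)
Definition C1_closure (Omega : set E) (phi : E -> R) : Prop :=
  exists U : set E, [/\ open U, closure Omega `<=` U & C1_on U phi].

Definition local_max_on (A : set E) (f : E -> R) (x : E) : Prop :=
  \forall y \near x, A y -> f y <= f x.

Definition local_min_on (A : set E) (f : E -> R) (x : E) : Prop :=
  \forall y \near x, A y -> f x <= f y.

Definition viscosity_subsolution (H : E -> E -> R) (Omega : set E)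
    (v : E -> R) : Prop :=
  BUC Omega v /\
  forall x phi, Omega x -> C1_on Omega phi ->
    local_max_on Omega (fun y => v y - phi y) x ->
    v x + H x (grad phi x) <= 0.

Definition viscosity_supersolution (H : E -> E -> R) (Omega : set E)
    (v : E -> R) : Prop :=
  BUC (closure Omega) v /\
  forall x phi, closure Omega x -> C1_closure Omega phi ->
    local_min_on (closure Omega) (fun y => v y - phi y) x ->
    0 <= v x + H x (grad phi x).

Definition state_constraint_solution (H : E -> E -> R) (Omega : set E)
    (v : E -> R) : Prop :=
  viscosity_subsolution H Omega v /\ viscosity_supersolution H Omega v.

Definition locally_lipschitz (K : E -> R) : Prop :=
  forall p : E, exists2 U, nbhs p U & [lipschitz K q | q in U].

Definition coercive (K : E -> R) : Prop :=
  forall M : R, exists r : R, forall p, r <= enorm p -> M <= K p.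

Definition separable_hamiltonian (H : E -> E -> R) : Prop :=
  exists (a K : E -> R) (alpha beta : R),
    [/\ 0 < alpha /\ 0 < beta,
        BUC setT a /\ (forall x, alpha <= a x <= beta),
        K 0 = 0,
        locally_lipschitz K /\ coercive K
      & H = (fun x p => a x * K p)].

End definitions.

(* Main.v *)
(* The tests against [N |y - x|^2] (N small on the whole space, N large in a
   ball) move the maximum of a bounded subsolution near [x] at the cost of a
   controlled gradient; since [H x p = O(|p|)] at [p = 0] this forces [u = 0] on
   the whole space, and since [H >= - A] it gives [u_k <= A] in the ball.
   Testing [u_k] at its minimum with a constant gives [0 <= u_k].  Coercivity
   upgrades the Lipschitz bound at [p = 0] to [- M |p| <= H x p] for all [p], so
   a subsolution satisfies [u_k <= M |D u_k|] and is dominated by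
   [A exp ((sqrt (1 + |x|^2) - k) / M)], which exceeds [A] on the boundary.

   The rate is attained for [K p = |2 |p| - 1| - 1] and [a = 1]: there the
   state-constraint solution is [exp ((|x| - k) / 2)], the supremum over unit
   vectors [e] of the smooth solutions [exp ((e . x - k) / 2)], each of which
   is a lower barrier for any supersolution. *)
Require Import Defs.
From mathcomp Require Import all_boot all_order all_algebra.
From mathcomp Require Import all_classical all_reals all_analysis.
From mathcomp Require Import ring lra.
Import Order.TTheory GRing.Theory Num.Theory.
Import numFieldNormedType.Exports.
Local Open Scope classical_set_scope.
Local Open Scope ring_scope.

(** * Euclidean inner product and norm, and their relation to the sup norm and its topology *)

Definition dot {R : realType} {n : nat} (x y : 'rV[R]_n) : R :=
  \sum_(i < n) x 0 i * y 0 i.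

Section euclidean_norm.
Context {R : realType} {n : nat}.
Implicit Types (x y z : 'rV[R]_n) (r : R).

Lemma dotC x y : dot x y = dot y x.
Proof. by apply: eq_bigr => i _; rewrite mulrC. Qed.

Lemma dotDl x y z : dot (x + y) z = dot x z + dot y z.
Proof. by rewrite -big_split; apply: eq_bigr => i _; rewrite mxE mulrDl. Qed.

Lemma dotZl r x y : dot (r *: x) y = r * dot x y.
Proof. by rewrite /dot mulr_sumr; apply: eq_bigr => i _; rewrite mxE mulrA. Qed.

Lemma dotDr x y z : dot z (x + y) = dot z x + dot z y.
Proof. by rewrite dotC dotDl !(dotC _ z). Qed.

Lemma dotZr r x y : dot y (r *: x) = r * dot y x.
Proof. by rewrite dotC dotZl dotC. Qed.

Lemma dot_ge0 x : 0 <= dot x x.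
Proof. by apply: sumr_ge0 => i _; rewrite -expr2 sqr_ge0. Qed.

Lemma enorm_ge0 x : 0 <= enorm x.
Proof. exact: sqrtr_ge0. Qed.

Lemma sqr_enorm x : enorm x ^+ 2 = dot x x.
Proof.
rewrite sqr_sqrtr; first by apply: eq_bigr => i _; rewrite expr2.
by apply: sumr_ge0 => i _; rewrite sqr_ge0.
Qed.

Lemma enormE x : enorm x = Num.sqrt (dot x x).
Proof. by rewrite -sqr_enorm sqrtr_sqr ger0_norm// enorm_ge0. Qed.

Lemma enorm0 : enorm (0 : 'rV[R]_n) = 0.
Proof.
by rewrite /enorm big1 ?sqrtr0// => i _; rewrite mxE expr0n.
Qed.

Lemma enormZ r x : enorm (r *: x) = `|r| * enorm x.
Proof.
by rewrite !enormE dotZl dotZr mulrA -expr2 sqrtrM ?sqr_ge0// sqrtr_sqr.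
Qed.

Lemma enormN x : enorm (- x) = enorm x.
Proof. by rewrite -scaleN1r enormZ normrN1 mul1r. Qed.

Lemma coord_le_enorm x i : `|x 0 i| <= enorm x.
Proof.
rewrite -(ler_pXn2r (n := 2)) ?nnegrE ?enorm_ge0//.
rewrite real_normK ?num_real// sqr_enorm /dot (bigD1 i)//= -expr2 lerDl.
by apply: sumr_ge0 => j _; rewrite -expr2 sqr_ge0.
Qed.

Lemma norm_le_enorm x : `|x| <= enorm x.
Proof.
rewrite [`|x|]mx_normrE; apply: bigmax_le; first exact: enorm_ge0.
by case=> i j _; rewrite ord1; exact: coord_le_enorm.
Qed.

Lemma enorm_eq0 x : (enorm x == 0) = (x == 0).
Proof.
apply/eqP/eqP => [x0|->]; last exact: enorm0.
by apply/eqP; rewrite -normr_eq0 eq_le normr_ge0 andbT -x0 norm_le_enorm.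
Qed.

(** Cauchy-Schwarz: for nonzero [x] and [y], expand the squared norm of
    [enorm y *: x - enorm x *: y], which is nonnegative, and divide by [enorm x * enorm y]. *)
Lemma dot_le x y : dot x y <= enorm x * enorm y.
Proof.
have [/eqP|x0] := eqVneq (enorm x) 0.
  rewrite enorm_eq0 => /eqP ->; rewrite enorm0 mul0r /dot big1// => i _.
  by rewrite mxE mul0r.
have [/eqP|y0] := eqVneq (enorm y) 0.
  rewrite enorm_eq0 => /eqP ->; rewrite enorm0 mulr0 /dot big1// => i _.
  by rewrite mxE mulr0.
have xy_gt0 : 0 < enorm x * enorm y.
  by rewrite mulr_gt0// lt0r ?x0 ?y0 enorm_ge0.
have := dot_ge0 (enorm y *: x - enorm x *: y).
rewrite -scaleNr dotDl !dotDr !dotZl !dotZr (dotC y x) -!sqr_enorm => h.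
by rewrite -(ler_pM2l xy_gt0); nra.
Qed.

Lemma enormD x y : enorm (x + y) <= enorm x + enorm y.
Proof.
rewrite -(ler_pXn2r (n := 2)) ?nnegrE ?addr_ge0 ?enorm_ge0//.
rewrite sqr_enorm dotDl !dotDr (dotC y x) -!sqr_enorm.
by have := dot_le x y; nra.
Qed.

Lemma enormB x y : enorm (x - y) = enorm (y - x).
Proof. by rewrite -enormN opprB. Qed.

Lemma ler_dist_enorm x y : `|enorm x - enorm y| <= enorm (x - y).
Proof.
have h (a b : 'rV[R]_n) : enorm a - enorm b <= enorm (a - b).
  by rewrite lerBlDr; have := enormD (a - b) b; rewrite subrK.
by rewrite ler_norml h andbT lerNl opprB enormB h.
Qed.

(** Together with [norm_le_enorm] this makes the two norms equivalent, so that Euclidean estimates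
    can be read in the library topology. The factor [n] instead of its square root is crude but
    sufficient: the squared norm is at most [n] times the squared sup norm, and [n <= n ^ 2]. *)
Lemma enorm_le_norm x : enorm x <= n%:R * `|x|.
Proof.
have h i : `|x 0 i| <= `|x|.
  rewrite [`|x|]mx_normrE.
  exact: (le_bigmax _ (fun ij : 'I_1 * 'I_n => `|x ij.1 ij.2|) (0, i)).
rewrite -(ler_pXn2r (n := 2)) ?nnegrE ?mulr_ge0 ?enorm_ge0//.
rewrite sqr_enorm /dot.
apply: (@le_trans _ _ (\sum_(i < n) `|x| ^+ 2)).
  apply: ler_sum => i _; rewrite -expr2 -real_normK ?num_real//.
  by rewrite ler_pXn2r ?nnegrE.
rewrite sumr_const card_ord exprMn -[leLHS]mulr_natl ler_wpM2r ?sqr_ge0//.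
by rewrite -natrX ler_nat; case: (n) => // m; rewrite expnS leq_pmulr.
Qed.

Lemma near_enorm x r : 0 < r -> \forall y \near x, enorm (y - x) < r.
Proof.
(* The successor keeps this radius positive also in dimension zero. *)
move=> r0; have e0 : 0 < r / n.+1%:R by rewrite divr_gt0.
near=> y; apply: le_lt_trans (enorm_le_norm _) _.
have h : `|y - x| < r / n.+1%:R.
  by near: y; exact: (@cvgr_distC_lt _ _ _ (nbhs x) _ id x cvg_id _ e0).
apply: (@le_lt_trans _ _ (n.+1%:R * `|y - x|)).
  by rewrite ler_wpM2r// ler_nat.
by rewrite mulrC -ltr_pdivlMr.
Unshelve. all: by end_near. Qed.

Lemma enorm_continuous : continuous (@enorm R n).
Proof.
move=> x; apply/(@cvgrPdist_lt _ _ _ (nbhs x)) => e e0.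
apply: filterS (near_enorm x e e0) => y.
by apply: le_lt_trans; rewrite enormB ler_dist_enorm.
Qed.

Lemma closed_enorm_le r : closed [set x : 'rV[R]_n | enorm x <= r].
Proof.
apply: (preimage_closed (D := [set y | y <= r])); last exact: closed_le.
by move=> x _; exact: enorm_continuous.
Qed.

Lemma closure_eball_le r x : closure (eball r) x -> enorm x <= r.
Proof.
by move=> xr; apply: (closed_enorm_le r); apply: closure_subset xr => y /ltW.
Qed.

Lemma open_eball r : open (eball r : set 'rV[R]_n).
Proof.
rewrite openE => x xr; rewrite /interior; near=> y; rewrite /eball/=.
have : enorm (y - x) < r - enorm x.
  by near: y; apply: near_enorm; rewrite subr_gt0.
by have := enormD (y - x) x; rewrite subrK; lra.
Unshelve. all: by end_near. Qed.

Lemma compact_enorm_le (A : set 'rV[R]_n) r :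
  closed A -> (forall x, A x -> enorm x <= r) -> compact A.
Proof.
move=> clA Ar; apply: bounded_closed_compact => //.
exists r; split => [|M rM x /Ar xr]; first by rewrite num_real.
exact: le_trans (norm_le_enorm x) (le_trans xr (ltW rM)).
Qed.

Lemma compact_closure_eball r : compact (closure (eball r : set 'rV[R]_n)).
Proof.
by apply: (compact_enorm_le _ r); [exact: closed_closure|exact: closure_eball_le].
Qed.

End euclidean_norm.

(** * Gradients, the chain rule and the basic C^1 functions *)

Section gradients.
Context {R : realType} {n : nat}.
Implicit Types (x y z v : 'rV[R]_n) (phi q : 'rV[R]_n -> R).

Lemma diff_gradE phi x v : differentiable phi x ->
  'd phi x v = dot (grad phi x) v.
Proof.
move=> dphi; rewrite {1}(row_sum_delta v) linear_sum; apply: eq_bigr => i _.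
by rewrite linearZ/= mxE deriveE// mulrC.
Qed.

Lemma grad_diff phi x (p : 'rV[R]_n) : differentiable phi x ->
  (forall v, 'd phi x v = dot p v) -> grad phi x = p.
Proof.
move=> dphi dE; apply/rowP => i; rewrite mxE deriveE// dE.
rewrite /dot (bigD1 i)//= mxE !eqxx mulr1 big1 ?addr0// => j ji.
by rewrite mxE (negbTE ji) andbF mulr0.
Qed.

Lemma grad_comp (f : R -> R) (df : R) q x :
  differentiable q x -> is_derive (q x) 1 f df ->
  differentiable (f \o q) x /\ grad (f \o q) x = df *: grad q x.
Proof.
move=> dq fdf; have dfq : differentiable f (q x).
  by apply/derivable1_diffP; exact: ex_derive.
have dc : differentiable (f \o q) x by exact: differentiable_comp.
split=> //; apply: grad_diff => // v.
rewrite diff_comp//= deriv1E; last exact: ex_derive.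
by rewrite derive1E derive_val diff_gradE// dotZl mulrC.
Qed.

Lemma C1_on_comp (f df : R -> R) q :
  C1_on setT q -> (forall x, is_derive (q x) 1 f (df (q x))) ->
  (forall x, {for q x, continuous df}) ->
  C1_on setT (f \o q) /\ forall x, grad (f \o q) x = df (q x) *: grad q x.
Proof.
move=> C1q fdf cdf; have gE x : grad (f \o q) x = df (q x) *: grad q x.
  by have [dq _] := C1q x I; have [] := grad_comp f (df (q x)) q x dq (fdf x).
split=> // x _; have [dq cq] := C1q x I.
split; first by have [] := grad_comp f (df (q x)) q x dq (fdf x).
rewrite (_ : grad (f \o q) = fun y => df (q y) *: grad q y); last exact/funext.
apply: continuousZ => //; apply: continuous_comp; last exact: cdf.
exact: differentiable_continuous.
Qed.

Lemma C1_on_cst (r : R) : C1_on setT (fun _ : 'rV[R]_n => r) /\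
  forall x, grad (fun=> r) x = 0.
Proof.
have gE x : grad (fun=> r) x = 0.
  by apply/rowP => i; rewrite !mxE derive_cst.
split=> // x _; split; first exact: differentiable_cst.
by rewrite (_ : grad _ = fun=> 0); [exact: cst_continuous|exact/funext].
Qed.

Lemma differentiable_dot (e x : 'rV[R]_n) : differentiable (dot e) x.
Proof.
rewrite (_ : dot e = \sum_(i < n) (fun y => e 0 i * y 0 i)); last first.
  by apply/funext => y; rewrite fct_sumE.
apply: differentiable_sum => i; apply: differentiableZ.
exact: differentiable_coord.
Qed.

Lemma C1_on_dot (e : 'rV[R]_n) :
  C1_on setT (dot e) /\ forall x, grad (dot e) x = e.
Proof.
(* By linearity the difference quotient in direction [v] equals [dot e v] for every nonzero step. *)
have gE x : grad (dot e) x = e.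
  apply: grad_diff => [|v]; first exact: differentiable_dot.
  rewrite -deriveE; last exact: differentiable_dot.
  apply/cvg_lim => //; apply/(@cvgrPdist_lt _ _ _ (0^')) => eps eps0.
  near=> h; rewrite /= (dotDr (h *: v) x e) dotZr addrK.
  rewrite /GRing.scale/= mulrA mulVf ?mul1r ?subrr ?normr0//.
  by near: h; exact: nbhs_dnbhs_neq.
split=> // x _; split; first exact: differentiable_dot.
by rewrite (_ : grad _ = fun=> e); [exact: cst_continuous|exact/funext].
Unshelve. all: by end_near. Qed.

Lemma C1_on_sqr_dist x :
  C1_on setT (fun y => dot (y - x) (y - x)) /\
  forall y, grad (fun z => dot (z - x) (z - x)) y = 2 *: (y - x).
Proof.
pose q := fun y => dot (y - x) (y - x).
have qE : q = \sum_(i < n) (fun y => y 0 i - x 0 i) ^+ 2.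
  apply/funext => y; rewrite fct_sumE; apply: eq_bigr => i _.
  by rewrite exprfctE !mxE expr2.
have dq y : differentiable q y.
  rewrite qE; apply: differentiable_sum => i; apply: differentiableX.
  by apply: differentiableB => //; exact: differentiable_coord.
have gE y : grad q y = 2 *: (y - x).
  apply: grad_diff => // v; rewrite -deriveE//.
  apply/cvg_lim => //; apply/(@cvgrPdist_lt _ _ _ (0^')) => eps eps0.
  (* The difference quotient misses its limit by exactly [h * dot v v]; adding 1 gives a positive
     divisor even when [v = 0]. *)
  have c0 : 0 < dot v v + 1 by have := dot_ge0 v; lra.
  near=> h; rewrite /q/= -addrA (dotDl (h *: v)) !(dotDr (h *: v) (y - x)).
  rewrite !dotZl !dotZr (dotC (y - x) v).
  have h0 : h != 0 by near: h; exact: nbhs_dnbhs_neq.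
  rewrite /GRing.scale/= (_ : _ - _ = - (h * dot v v)); last by field.
  rewrite normrN normrM (ger0_norm (dot_ge0 v)).
  apply: (@le_lt_trans _ _ (`|h| * (dot v v + 1))).
    by rewrite ler_wpM2l// lerDl.
  rewrite -ltr_pdivlMr//; near: h; apply: dnbhs0_lt; exact: divr_gt0.
split=> // y _; split; first exact: dq.
rewrite (_ : grad _ = fun y => 2 *: (y - x)); last exact/funext.
apply: continuousZr; apply: continuousB; first exact: cvg_id.
exact: cst_continuous.
Unshelve. all: by end_near. Qed.

End gradients.

(** * Bounded uniformly continuous functions *)

Section BUC_facts.
Context {R : realType} {n : nat}.
Implicit Types (x y : 'rV[R]_n) (A : set 'rV[R]_n) (u : 'rV[R]_n -> R).

Lemma BUC_bounded A u : BUC A u ->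
  exists2 B : R, 0 < B & forall x, A x -> `|u x| <= B.
Proof.
move=> [[M [_ bM]] _]; exists (`|M| + 1); first by rewrite ltr_wpDl.
by move=> x; apply: bM; rewrite ltr_pwDr// ler_norm.
Qed.

Lemma BUC_continuous A u : BUC A u -> {within A, continuous u}.
Proof.
move=> [_ /(@unif_continuousP _ (subspace A) _ u) uu] x.
apply/cvg_ballP => e e0; have [d d0 ud] := uu e e0.
by apply/nbhs_ballP; exists d => // y xy; exact: (ud (x, y)).
Qed.

Lemma BUC_lipschitz A u (B k : R) : 0 <= k -> (forall x, A x -> `|u x| <= B) ->
  (forall x y, A x -> A y -> `|u x - u y| <= k * enorm (x - y)) -> BUC A u.
Proof.
move=> k0 uB uk; split.
  exists B; split=> [|M BM x Ax]; first exact: num_real.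
  exact: le_trans (uB x Ax) (ltW BM).
apply/(@unif_continuousP _ (subspace A) _ u) => e e0.
(* The Lipschitz constant for the sup norm is [k * n%:R], which may vanish; the added 1 makes it a
   divisor. *)
have c0 : 0 < k * n%:R + 1 by rewrite ltr_wpDl// mulr_ge0.
exists (e / (k * n%:R + 1)) => /=; first exact: divr_gt0.
move=> [x y]; rewrite /= {1}/ball/= /subspace_ball.
case: ifPn => [/set_mem Ax [Ay]|_ ->]; last exact: ballxx.
rewrite -!ball_normE/= ltr_pdivlMr// => xy.
apply: le_lt_trans xy; apply: le_trans (uk x y Ax Ay) _.
rewrite mulrDr mulr1; apply: ler_wpDr => //.
by rewrite mulrCA ler_wpM2l// mulrC enorm_le_norm.
Qed.

End BUC_facts.

(** * Viscosity tests: quadratic penalisation and comparison with smooth functions *)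

Section test_functions.
Context {R : realType} {n : nat}.
Implicit Types (x y z : 'rV[R]_n) (phi u v : 'rV[R]_n -> R).
Implicit Types (H : 'rV[R]_n -> 'rV[R]_n -> R) (U : set 'rV[R]_n).

Lemma C1_onS U phi : C1_on setT phi -> C1_on U phi.
Proof. by move=> C1phi x _; exact: C1phi. Qed.

Lemma C1_closureT U phi : C1_on setT phi -> C1_closure U phi.
Proof. by exists setT; split=> //; exact: openT. Qed.

Lemma C1_on_scale (r : R) phi : C1_on setT phi ->
  C1_on setT (fun x => r * phi x) /\
  forall x, grad (fun x => r * phi x) x = r *: grad phi x.
Proof.
move=> C1phi; apply: (C1_on_comp ( *%R r) (fun=> r)) => // x.
  have := @is_deriveZ _ _ _ id r (phi x) 1 1 (is_derive_id _ _).
  by rewrite [_ *: _]mulr1.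
exact: cst_continuous.
Qed.

Lemma C1_on_continuous phi : C1_on setT phi -> continuous phi.
Proof.
by move=> C1phi x; apply: differentiable_continuous; case: (C1phi x I).
Qed.

(** Maximise over the closed ball of radius [r] about [x]. Comparison with the value at [x] shows
    that the penalty at the maximiser is at most [2 * B], below its value [N * r ^+ 2] on the
    sphere. The maximiser is thus interior to the ball, and the maximum is a local one on [U]. *)
Lemma penalised_max U v x (B N r : R) :
  0 < N -> 0 < r -> (forall y, enorm (y - x) <= r -> U y) ->
  {within U, continuous v} -> (forall y, U y -> `|v y| <= B) ->
  2 * B < N * r ^+ 2 ->
  exists y, [/\ U y, local_max_on U (fun z => v z - N * dot (z - x) (z - x)) y,
    v x <= v y & N * enorm (y - x) ^+ 2 <= 2 * B].
Proof.
move=> N0 r0 xU cv vB BN; pose A := [set y | enorm (y - x) <= r].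
have Ax : A x by rewrite /A/= subrr enorm0 ltW.
have cA : compact A.
  apply: (compact_enorm_le _ (enorm x + r)) => [|y Ay].
    apply: (preimage_closed (f := fun y => enorm (y - x))
      (D := [set y | y <= r])).
      move=> y _; apply: continuous_comp; last exact: enorm_continuous.
      by apply: continuousB; [exact: cvg_id|exact: cst_continuous].
    exact: closed_le.
  have := enormD x (y - x); rewrite addrC subrK => /le_trans; apply.
  by rewrite lerD2l.
have C1q := (C1_on_scale N _ (C1_on_sqr_dist x).1).1.
have cf : {within A, continuous (fun z => v z - N * dot (z - x) (z - x))}.
  move=> z; apply: cvgB; first exact: (continuous_subspaceW xU cv).
  exact: continuous_subspaceT (C1_on_continuous _ C1q) z.
have [y /set_mem Ay ymax] := compact_EVT_max (ex_intro _ x Ax) cA cf.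
have := ymax x (mem_set Ax); 
rewrite -!sqr_enorm subrr enorm0 expr0n mulr0 subr0 => xy.
have Uy := xU _ Ay.
have q0 : 0 <= N * enorm (y - x) ^+ 2 by rewrite mulr_ge0 ?sqr_ge0// ltW.
have q2B : N * enorm (y - x) ^+ 2 <= 2 * B.
  have := vB y Uy; have := vB x (xU _ Ax).
  rewrite !ler_norml => /andP[? ?] /andP[? ?].
  by lra.
have yr : enorm (y - x) < r.
  rewrite -(ltr_pXn2r (n := 2)) ?nnegrE ?enorm_ge0 ?(ltW r0)//.
  by rewrite -(ltr_pM2l N0); exact: le_lt_trans BN.
exists y; split=> //; last by lra.
have e0 : 0 < r - enorm (y - x) by rewrite subr_gt0.
apply: filterS (near_enorm y _ e0) => z zy _; apply: ymax; apply/mem_set.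
rewrite /A/=; have := enormD (z - y) (y - x); rewrite addrA subrK; lra.
Qed.

Lemma penalised_subsolution H U v x (B N r : R) :
  0 < N -> 0 < r -> (forall y, enorm (y - x) <= r -> U y) ->
  {within U, continuous v} -> (forall y, U y -> `|v y| <= B) ->
  2 * B < N * r ^+ 2 ->
  (forall y phi, U y -> C1_on setT phi ->
    local_max_on U (fun z => v z - phi z) y -> v y + H y (grad phi y) <= 0) ->
  exists y, [/\ U y, v x <= v y, N * enorm (y - x) ^+ 2 <= 2 * B &
    v y + H y ((2 * N) *: (y - x)) <= 0].
Proof.
move=> N0 r0 xU cv vB BN vsub.
have [y [Uy ymax xy yB]] := penalised_max U v x B N r N0 r0 xU cv vB BN.
exists y; split=> //; have [C1q gq] := C1_on_sqr_dist x.
have [C1Nq gNq] := C1_on_scale N _ C1q.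
by have := vsub y _ Uy C1Nq ymax; rewrite gNq gq scalerA mulrC.
Qed.

(** On the whole space the penalty may be as weak as desired, since the ball has room to grow. The
    gradient [p] at the penalised maximum [y] is then small, and [v x <= v y <= L * enorm p]. *)
Lemma bounded_subsolution_le0 H v (L d : R) : 0 < L -> 0 < d ->
  continuous v -> (exists2 B : R, 0 < B & forall x, `|v x| <= B) ->
  (forall x p, enorm p <= d -> - (L * enorm p) <= H x p) ->
  (forall y phi, C1_on setT phi ->
    local_max_on setT (fun z => v z - phi z) y -> v y + H y (grad phi y) <= 0) ->
  forall x, v x <= 0.
Proof.
move=> L0 d0 cv [B B0 vB] HL vsub x; apply/ler_addgt0Pr => e e0; rewrite add0r.
(* The bound [d] keeps the gradient where the lower bound on [H] holds, and [e / L] makes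
   [L * enorm p] at most [e]. *)
pose d' := Num.min d (e / L).
have d'0 : 0 < d' by rewrite lt_min d0 divr_gt0.
(* With [p = 2 N (y - x)] and [N |y - x|^2 <= 2 B], one gets [|p|^2 <= 8 B N], which this choice
   makes equal to [d' ^+ 2]. *)
pose N := d' ^+ 2 / (8 * B).
have N0 : 0 < N by rewrite divr_gt0 ?exprn_gt0 ?mulr_gt0.
(* Then [N * r = 2 * B + N] exceeds [2 * B], and [r > 1] preserves this for [N * r ^+ 2]. *)
pose r := 2 * B / N + 1.
have r1 : 1 < r by rewrite /r ltrDr divr_gt0// mulr_gt0.
have BN : 2 * B < N * r ^+ 2.
  have rN : N * r = 2 * B + N.
    by rewrite /r; clearbody N; field; rewrite gt_eqF.
  rewrite expr2 mulrA rN; have : 0 < (2 * B + N) * (r - 1).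
    by rewrite mulr_gt0 ?subr_gt0// addr_gt0// mulr_gt0.
  by rewrite mulrBr mulr1; lra.
have r0 : 0 < r by lra.
have [//|||y [_ xy yB Hy]] := penalised_subsolution H setT v x B N r N0 r0
  _ _ (fun y _ => vB y) BN _.
- exact: continuous_subspaceT.
- by move=> y phi _; exact: vsub.
have pd : enorm ((2 * N) *: (y - x)) <= d'.
  rewrite -(ler_pXn2r (n := 2)) ?nnegrE ?enorm_ge0 ?(ltW d'0)//.
  rewrite enormZ exprMn real_normK ?num_real//.
  rewrite [leRHS](_ : _ = 4 * N * (2 * B)); last by rewrite /N; field; lra.
  rewrite [leLHS](_ : _ = 4 * N * (N * enorm (y - x) ^+ 2)); last by ring.
  by rewrite ler_pM2l// mulr_gt0.
move: pd; rewrite le_min => /andP[/(HL y) pd].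
by rewrite ler_pdivlMr// mulrC => ?; lra.
Qed.

(** A strong penalty keeps the maximiser inside the ball; no control of its gradient is needed,
    because [v x <= v y <= - H y p <= A] for any [p]. *)
Lemma subsolution_le_max H (k A : R) v : (forall x p, - A <= H x p) ->
  viscosity_subsolution H (eball k) v -> forall x, eball k x -> v x <= A.
Proof.
move=> HA [Bv vsub] x; rewrite /eball/= => xk.
have [B B0 vB] := BUC_bounded _ _ Bv.
(* Half the distance to the sphere leaves the closed ball about [x] inside [eball k], and
   [N * r ^+ 2 = 4 * B]. *)
pose r := (k - enorm x) / 2; pose N := 4 * B / r ^+ 2.
have r0 : 0 < r by rewrite /r; lra.
have BN : 2 * B < N * r ^+ 2 by rewrite /N divfK ?expf_eq0 ?gt_eqF//; lra.
have N0 : 0 < N by rewrite /N divr_gt0 ?exprn_gt0// mulr_gt0.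
have [|||y [_ xy _]] :=
  penalised_subsolution H (eball k) v x B N r N0 r0 _ _ vB BN _.
- move=> y yr; rewrite /eball/=; have := enormD (y - x) x.
  by rewrite subrK; move: yr; rewrite /r; lra.
- exact: BUC_continuous.
- by move=> y phi yk /(C1_onS (eball k)); exact: vsub.
by have := HA y ((2 * N) *: (y - x)); lra.
Qed.

Lemma le_closure U v (A : R) : {within closure U, continuous v} ->
  (forall x, U x -> v x <= A) -> forall x, closure U x -> v x <= A.
Proof.
move=> cv vA x Ux; apply/ler_addgt0Pr => e e0.
have : \forall y \near x, closure U y -> v x - v y < e.
  have /subspace_continuousP/(_ x Ux)/cvgrPdist_lt/(_ e e0) := cv.
  move=> cvx; apply: (@filterS _ (nbhs x) _ _ _ _ cvx) => y h Uy.
  exact: le_lt_trans (ler_norm _) (h Uy).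
move=> /Ux [y [Uy /(_ (subset_closure Uy))]]; have := vA y Uy; lra.
Qed.

(** Take a minimum [y] of [v - phi] on the compact closed ball. The supersolution property holds up
    to the boundary, so wherever [y] lies [v y >= - H y (grad phi y) >= phi y], and the minimum is
    nonnegative. *)
Lemma supersolution_ge_test H (k : R) v phi :
  viscosity_supersolution H (eball k) v -> C1_on setT phi ->
  (forall x, closure (eball k) x -> phi x + H x (grad phi x) <= 0) ->
  forall x, closure (eball k) x -> phi x <= v x.
Proof.
move=> [Bv vsup] C1phi phiH x xk.
have cA := @compact_closure_eball R n k.
have cf : {within closure (eball k), continuous (fun z => v z - phi z)}.
  move=> z; apply: cvgB; first exact: (BUC_continuous _ _ Bv).
  exact: continuous_subspaceT (C1_on_continuous _ C1phi) z.
have [y /set_mem Ay ymin] := compact_EVT_min (ex_intro _ x xk) cA cf.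
have : 0 <= v y + H y (grad phi y).
  apply: vsup => //; first exact: C1_closureT.
  by apply: (@nearW _ (nbhs y)) => z zk; apply: ymin; exact: mem_set.
by have := phiH y Ay; have := ymin x (mem_set xk); lra.
Qed.

Lemma supersolution_ge0 H (k : R) v : (forall x, H x 0 = 0) ->
  viscosity_supersolution H (eball k) v ->
  forall x, closure (eball k) x -> 0 <= v x.
Proof.
move=> H0 vsup; have [C1c gc] := @C1_on_cst R n 0.
by apply: (supersolution_ge_test H k v _ vsup C1c) => x _; rewrite gc H0 addr0.
Qed.

End test_functions.

(** * The exponential barrier and the upper bound for subsolutions *)

Section exponential_bound.
Context {R : realType} {n : nat}.
Implicit Types (x y : 'rV[R]_n) (v q : 'rV[R]_n -> R).
Implicit Types (H : 'rV[R]_n -> 'rV[R]_n -> R).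

Lemma is_derive_affine (k M s : R) : is_derive s 1 (fun t => (t - k) / M) M^-1.
Proof.
have h : is_derive s 1 (id - cst k) (1 - 0 : R) by exact: is_deriveB.
have := is_deriveZ M^-1 h; rewrite subr0 [_ *: _]mulr1.
rewrite (_ : _ \*: _ = fun t => (t - k) / M)//.
by apply/funext => t; rewrite /= mulrC.
Qed.

Lemma C1_on_exp (k M : R) q : C1_on setT q ->
  C1_on setT (fun x => expR ((q x - k) / M)) /\
  forall x, grad (fun x => expR ((q x - k) / M)) x =
    (expR ((q x - k) / M) / M) *: grad q x.
Proof.
move=> C1q.
have [C1a ga] := C1_on_comp _ (fun=> M^-1) _ C1q
  (fun x => is_derive_affine k M (q x)) (fun x => @cst_continuous R R _ (q x)).
have [C1e ge] := C1_on_comp expR expR _ C1a (fun x => is_derive_expR _)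
  (fun x => @continuous_expR R _).
by split=> // x; rewrite ge ga scalerA.
Qed.

Lemma C1_on_sqrt1D q : C1_on setT q -> (forall x, 0 <= q x) ->
  C1_on setT (fun x => Num.sqrt (1 + q x)) /\
  forall x, grad (fun x => Num.sqrt (1 + q x)) x =
    (2 * Num.sqrt (1 + q x))^-1 *: grad q x.
Proof.
move=> C1q q0; have s0 x : 0 < 1 + q x by rewrite ltr_pwDl.
(* The map [s |-> 1 + s], written in the shape covered by [is_derive_affine]. *)
pose aff (s : R) := (s - (-1)) / 1.
have affE x : aff (q x) = 1 + q x by rewrite /aff divr1 opprK addrC.
have [C1a ga] := C1_on_comp aff (fun=> 1^-1) _ C1q
  (fun x => is_derive_affine (-1) 1 (q x)) (fun x => @cst_continuous R R _ (q x)).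
have [||C1s gs] :=
    C1_on_comp Num.sqrt (fun s => (2 * Num.sqrt s)^-1) _ C1a.
- by move=> x; apply: is_derive1_sqrt; rewrite /= affE.
- move=> x /=; rewrite affE; apply: continuousV.
    by rewrite mulf_neq0// gt_eqF// sqrtr_gt0.
  by apply: continuousM; [exact: cst_continuous|exact: sqrt_continuous].
have E : Num.sqrt \o (aff \o q) = fun x => Num.sqrt (1 + q x).
  by apply/funext => x; rewrite /= affE.
rewrite -E; split=> // x.
by rewrite gs ga /= affE invr1 scale1r.
Qed.

(* A smooth substitute for [A * expR ((enorm x - k) / M)], which has a kink at
   the origin. *)
Definition barrier (A M k : R) x : R :=
  A * expR ((Num.sqrt (1 + dot (x - 0) (x - 0)) - k) / M).

(** The gradient is [barrier / M] times [x / sqrt (1 + |x|^2)], a vector of norm at most 1. *)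
Lemma barrierC1 (A M k : R) : 0 < A -> 0 < M ->
  C1_on setT (barrier A M k) /\
  forall x, M * enorm (grad (barrier A M k) x) <= barrier A M k x.
Proof.
move=> A0 M0; have [C1q gq] := @C1_on_sqr_dist R n 0.
have [C1s gs] := C1_on_sqrt1D _ C1q (fun x => dot_ge0 _).
have [C1e ge] := C1_on_exp k M _ C1s.
have [C1w gw] := C1_on_scale A _ C1e.
split=> // x; rewrite gw ge gs gq !scalerA enormZ subr0 /barrier subr0.
set s := Num.sqrt _.
have s0 : 0 < s by rewrite sqrtr_gt0 ltr_pwDl// dot_ge0.
have xs : enorm x <= s by rewrite enormE ler_wsqrtr// lerDr.
set w := expR _; have w0 : 0 < w := expR_gt0 _.
have -> : A * (w / M) * (2 * s)^-1 * 2 = A * w / M / s.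
  by field; rewrite !gt_eqF.
rewrite gtr0_norm ?divr_gt0 ?mulr_gt0//.
have -> : M * (A * w / M / s * enorm x) = A * w * (enorm x / s).
  by field; rewrite !gt_eqF.
rewrite -[leRHS]mulr1 ler_wpM2l ?mulr_ge0 ?(ltW A0) ?(ltW w0)//.
by rewrite ler_pdivrMr// mul1r.
Qed.

Lemma barrier_ge (A M k : R) x : 0 < A -> 0 < M -> k <= enorm x ->
  A <= barrier A M k x.
Proof.
move=> A0 M0 kx; rewrite -[leLHS]mulr1 ler_pM2l// -[leLHS]expR0 ler_expR.
rewrite divr_ge0 ?(ltW M0)// subr_ge0; apply: le_trans kx _.
by rewrite enormE subr0 ler_wsqrtr// lerDr.
Qed.

(** From [sqrt (1 + |x|^2) <= 1 + |x|]: the factor [expR M^-1] is the price of smoothing the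
    norm. *)
Lemma barrier_le (A M k : R) x : 0 < A -> 0 < M ->
  barrier A M k x <= A * expR M^-1 * expR (enorm x / M) * expR (- (k / M)).
Proof.
move=> A0 M0; rewrite -!mulrA ler_pM2l// -!expRD ler_expR.
rewrite [leRHS](_ : _ = (1 + enorm x - k) / M); last by field; rewrite gt_eqF.
rewrite ler_pM2r ?invr_gt0// lerD2r.
rewrite subr0 -(ler_pXn2r (n := 2)) ?nnegrE ?addr_ge0 ?enorm_ge0 ?sqrtr_ge0//.
rewrite sqr_sqrtr ?addr_ge0 ?dot_ge0// -sqr_enorm.
by have := enorm_ge0 x; nra.
Qed.

(** Compare [v] with [barrier A M k] at a maximum [y] of their difference over the closed ball. *)
Lemma subsolution_le_exp H (A M k : R) v : 0 < A -> 0 < M ->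
  (forall x p, - A <= H x p) -> (forall x p, - (M * enorm p) <= H x p) ->
  viscosity_subsolution H (eball k) v ->
  {within closure (eball k), continuous v} ->
  forall x, closure (eball k) x ->
    v x <= A * expR M^-1 * expR (enorm x / M) * expR (- (k / M)).
Proof.
move=> A0 M0 HA HM vsub cv x xk; apply: le_trans (barrier_le _ _ _ _ A0 M0).
have [C1w gw] := barrierC1 A M k A0 M0.
have vA := le_closure _ _ A cv (subsolution_le_max H k A v HA vsub).
have cA := @compact_closure_eball R n k.
have cf : {within closure (eball k),
    continuous (fun z => v z - barrier A M k z)}.
  move=> z; apply: cvgB; first exact: cv.
  exact: continuous_subspaceT (C1_on_continuous _ C1w) z.
have [y /set_mem Ay ymax] := compact_EVT_max (ex_intro _ x xk) cA cf.
have := ymax x (mem_set xk); suff : v y <= barrier A M k y by lra.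
(* On the sphere [v <= A <= barrier]. At an interior maximum the barrier is a test function, and [v
   y <= M * enorm (grad (barrier A M k) y) <= barrier A M k y]. *)
have [yk|ky] := ltP (enorm y) k; last first.
  exact: le_trans (vA y Ay) (barrier_ge _ _ _ _ A0 M0 ky).
have : v y + H y (grad (barrier A M k) y) <= 0.
  have [_] := vsub; apply => //; first exact: C1_onS.
  apply: (@nearW _ (nbhs y)) => z zk; apply: ymax; apply/mem_set.
  exact: subset_closure.
by have := gw y; have := HM y (grad (barrier A M k) y); lra.
Qed.

End exponential_bound.

(** * Estimates on the separable Hamiltonian, and vanishing of the whole-space solution *)

Section hamiltonian_estimates.
Context {R : realType} {n : nat}.
Implicit Types (H : 'rV[R]_n -> 'rV[R]_n -> R) (K : 'rV[R]_n -> R).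

Lemma locally_lipschitz_near0 K : locally_lipschitz K -> K 0 = 0 ->
  exists d L : R, [/\ 0 < d, 0 < L &
    forall p, enorm p <= d -> `|K p| <= L * enorm p].
Proof.
move=> /(_ 0)[U U0 [M [_ lipK]]] K0.
have /nbhs_ballP[e /= e0 eU] := U0.
(* Halving fits the closed Euclidean ball into the open sup ball of radius [e]; [|M| + 1] is
   positive and strictly above [M], as the form of the Lipschitz hypothesis requires. *)
exists (e / 2), (`|M| + 1); split => [||p pe]; rewrite ?divr_gt0 ?ltr_wpDl//.
have Up : U p.
  apply: eU; rewrite -ball_normE/= sub0r normrN.
  by apply: le_lt_trans (norm_le_enorm p) _; lra.
have MM : M < `|M| + 1 by rewrite ltr_pwDr// ler_norm.
have := lipK _ MM (p, 0) (conj Up (nbhs_singleton U0)).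
rewrite /= K0 !subr0 => /le_trans; apply; rewrite ler_wpM2l ?addr_ge0//.
exact: norm_le_enorm.
Qed.

Lemma locally_lipschitz_continuous K : locally_lipschitz K -> continuous K.
Proof.
move=> lK p; have [U Up [M [_ lipK]]] := lK p.
have MM : M < `|M| + 1 by rewrite ltr_pwDr// ler_norm.
have M1 : 0 < `|M| + 1 by rewrite ltr_wpDl.
apply/(@cvgrPdist_lt _ _ _ (nbhs p)) => e e0.
near=> y.
have Uy : U y by near: y.
apply: le_lt_trans (lipK _ MM (p, y) (conj (nbhs_singleton Up) Uy)) _.
rewrite mulrC -ltr_pdivlMr//=; near: y.
apply: cvgr_dist_lt; [exact: cvg_id | exact: divr_gt0].
Unshelve. all: by end_near. Qed.

(** Coercivity gives [K >= 0] outside a ball, and on the compact ball [K] attains its minimum. The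
    radius is taken as an absolute value so that the ball contains 0. *)
Lemma coercive_bounded_below K : continuous K -> coercive K ->
  exists2 m : R, 0 < m & forall p, - m <= K p.
Proof.
move=> cK /(_ 0)[r rK].
have cA : compact [set p : 'rV[R]_n | enorm p <= `|r|].
  by apply: (compact_enorm_le _ `|r|) => //; exact: closed_enorm_le.
have A0 : [set p : 'rV[R]_n | enorm p <= `|r|] 0 by rewrite /= enorm0.
have [y _ ymin] := compact_EVT_min (ex_intro _ 0 A0) cA (continuous_subspaceT cK).
exists (`|K y| + 1) => [|p]; first by rewrite ltr_wpDl.
have [pr|rp] := leP (enorm p) `|r|; last first.
  apply: le_trans (rK p (le_trans (ler_norm r) (ltW rp))).
  by rewrite oppr_le0 addr_ge0.
have := ymin p (mem_set pr); have := ler_norm (- K y); rewrite normrN; lra.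
Qed.

Lemma separable_estimates H : separable_hamiltonian H ->
  [/\ forall x, H x 0 = 0,
    exists d L : R, [/\ 0 < d, 0 < L &
      forall x p, enorm p <= d -> `|H x p| <= L * enorm p]
    & exists2 A : R, 0 < A & forall x p, - A <= H x p].
Proof.
move=> [a [K [alpha [beta [[al0 be0] [_ ab] K0 [lK cK] ->]]]]].
have a0 x : 0 < a x by have /andP[/(lt_le_trans al0)] := ab x.
have abe x : a x <= beta by have /andP[] := ab x.
split=> [x||]; first by rewrite K0 mulr0.
  have [d [L [d0 L0 KL]]] := locally_lipschitz_near0 K lK K0.
  exists d, (beta * L); split => [//||x p /KL pL]; first exact: mulr_gt0.
  by rewrite normrM (gtr0_norm (a0 x)) -mulrA ler_pM// ltW.
have [m m0 Km] := coercive_bounded_below K (locally_lipschitz_continuous K lK) cK.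
exists (beta * m) => [|x p]; first exact: mulr_gt0.
(* Since [a x > 0], this gives [a x * K p >= - (a x * m)], and [a x <= beta] finishes. *)
have : a x * (K p + m) >= 0.
  by rewrite mulr_ge0 ?(ltW (a0 x))//; have := Km p; lra.
have : (beta - a x) * m >= 0 by rewrite mulr_ge0 ?subr_ge0// ltW.
by rewrite mulrDr mulrBl; lra.
Qed.

(** Small gradients are covered by [L]; when [enorm p > d], the constant [A] is itself at most
    [A / d * enorm p]. *)
Lemma linear_lower_bound H (d L A : R) : 0 < d -> 0 < L -> 0 < A ->
  (forall x p, enorm p <= d -> `|H x p| <= L * enorm p) ->
  (forall x p, - A <= H x p) ->
  forall x p, - (Num.max L (A / d) * enorm p) <= H x p.
Proof.
move=> d0 L0 A0 HL HA x p; rewrite lerNl; have [pd|dp] := leP (enorm p) d.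
  apply: (@le_trans _ _ (L * enorm p)).
    by apply: le_trans (HL x p pd); rewrite -normrN ler_norm.
  by rewrite ler_wpM2r ?enorm_ge0// le_max lexx.
apply: (@le_trans _ _ (A / d * enorm p)).
  rewrite mulrAC ler_pdivlMr//; have := HA x p.
  have : A * (enorm p - d) >= 0 by rewrite mulr_ge0 ?subr_ge0 ?(ltW A0) ?(ltW dp).
  by nra.
by rewrite ler_wpM2r ?enorm_ge0// le_max lexx orbT.
Qed.

Lemma whole_space_solution_eq0 H u : separable_hamiltonian H ->
  state_constraint_solution H setT u -> forall x, u x = 0.
Proof.
move=> /separable_estimates[_ [d [L [d0 L0 HL]]] _] [[Bu usub] [_ usup]] x.
have uB : exists2 B : R, 0 < B & forall x, `|u x| <= B.
  by have [B B0 uB] := BUC_bounded _ _ Bu; exists B => // y; exact: uB.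
have cu : continuous u.
  move=> y; have := BUC_continuous _ _ Bu.
  by rewrite continuous_open_subspace; [apply; rewrite inE|exact: openT].
apply/eqP; rewrite eq_le; apply/andP; split.
  apply: (bounded_subsolution_le0 H u L d) => // [y p /(HL y)|y phi];
    last exact: usub.
  by rewrite ler_norml => /andP[].
(* The lower bound is the upper bound for [- u], a subsolution for the reflected Hamiltonian
   [- H y (- p)]: a local maximum of [- u - phi] is a local minimum of [u - (- phi)], so [u] is
   tested with [- phi]. *)
rewrite -oppr_le0.
apply: (bounded_subsolution_le0 (fun y p => - H y (- p)) (fun y => - u y) L d)
  => //.
- by move=> y; apply: (@cvgN _ _ _ (nbhs y) _ u (u y)); exact: cu.
- by have [B B0 u'] := uB; exists B => // y; rewrite normrN.
- move=> y p; rewrite -enormN => /(HL y); rewrite ler_norml => /andP[_]; lra.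
move=> y phi C1phi umax; have [C1Nphi gN] := C1_on_scale (-1) _ C1phi.
have := usup y _ _ (C1_closureT _ _ C1Nphi).
rewrite closureT gN scaleN1r => /(_ I) h; rewrite -opprD oppr_le0; apply: h.
apply: (@filterS _ (nbhs y) _ _ _ _ umax) => z uz _; have := uz I; lra.
Qed.

End hamiltonian_estimates.

(** * Comparison of derivatives along half-lines *)

Section one_sided_derivatives.
Context {R : realType} {n : nat}.

(** Serves to compare the gradient of a test function along a ray with an explicit exponential
    profile; working to the right of 0 only lets the kink of the norm be handled like any other
    point. *)
Lemma ler_derive_right (F G : R -> R) (a b : R) :
  is_derive (0 : R) (1 : R) F a -> is_derive (0 : R) (1 : R) G b ->
  (\forall h \near 0^'+, F h - F 0 <= G h - G 0) -> a <= b.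
Proof.
have right (f : R -> R) (c : R) : is_derive (0 : R) (1 : R) f c ->
    (h^-1 * (f h - f 0)) @[h --> 0^'+] --> c.
  move=> [df <-].
  have -> : (fun h => h^-1 * (f h - f 0)) =
      fun h : R => h^-1 *: ((f \o shift 0) (h *: (1 : R)) - f 0).
    by apply/funext => h /=; rewrite addr0 [h *: 1]mulr1.
  move=> P /df /nbhs_ballP[e /= e0 eP]; exists e => //= y ye /gt_eqF/negbT.
  exact: eP.
move=> /right Fa /right Gb FG; apply: ler_cvg_to Fa Gb _.
near=> h; rewrite ler_wpM2l//.
  by rewrite invr_ge0 ltW//; near: h; exact: nbhs_right_gt.
by near: h.
Unshelve. all: by end_near. Qed.

Lemma is_derive_line (phi : 'rV[R]_n -> R) (x v : 'rV[R]_n) :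
  differentiable phi x ->
  is_derive (0 : R) (1 : R) (fun h : R => phi (h *: v + x)) (dot (grad phi x) v).
Proof.
move=> dphi; apply: DeriveDef.
  apply/(iffLR (@derivable1P _ _ _ phi x v)); exact (diff_derivable dphi).
rewrite -diff_gradE// -deriveE// /derive.
rewrite (_ : (fun h : R => h^-1 *: _) =
  fun h : R => h^-1 *: ((phi \o shift x) (h *: v) - phi x))//.
by apply/funext => h /=; rewrite addr0 scale0r add0r [h *: 1]mulr1.
Qed.

Lemma near_line (x v : 'rV[R]_n) (P : set 'rV[R]_n) :
  (\forall y \near x, P y) -> \forall h \near (0 : R)^'+, P (h *: v + x).
Proof.
have : (fun h : R => h *: v + x) @ (0:R) --> 0 *: v + x.
  by apply: cvgD; [apply: cvgZr_tmp; exact: cvg_id|exact: cvg_cst].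
rewrite scale0r add0r => /cvg_at_right_filter cx xP; exact: cx xP.
Qed.

End one_sided_derivatives.

(** * A nonconvex Hamiltonian whose solution decays exactly exponentially *)

Section optimality.
Context {R : realType} {n : nat}.
Implicit Types (x y p v e : 'rV[R]_n).

(** Equals [- 2 |p|] for [|p| <= 1/2], where it reaches its minimum [- 1], and [2 |p| - 2] beyond.
    The linear lower bound of slope 2 is therefore attained near 0. *)
Definition opt_K p : R := `|2 * enorm p - 1| - 1.

(** The factor 1 is the coefficient [a], kept so that the separable form matches literally. *)
Definition opt_H x p : R := 1 * opt_K p.

Lemma opt_H_ge_cst x p : - 1 <= opt_H x p.
Proof.
by rewrite /opt_H mul1r /opt_K; have := normr_ge0 (2 * enorm p - 1); lra.
Qed.

Lemma opt_H_ge_linear x p : - (2 * enorm p) <= opt_H x p.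
Proof.
by rewrite /opt_H mul1r /opt_K; have := ler_norm (- (2 * enorm p - 1));
  rewrite normrN; lra.
Qed.

Lemma opt_H_small x p : 2 * enorm p <= 1 -> opt_H x p = - (2 * enorm p).
Proof. by move=> p1; rewrite /opt_H mul1r /opt_K ler0_norm; lra. Qed.

Lemma opt_H_separable : separable_hamiltonian opt_H.
Proof.
exists (fun=> 1), opt_K, 1, 1; split=> //.
- split=> [|x]; last by rewrite lexx.
  apply: (BUC_lipschitz _ _ 1 0) => // [x _|x y _ _]; first by rewrite normr1.
  by rewrite subrr normr0 mul0r.
- by rewrite /opt_K enorm0 mulr0 sub0r normrN normr1 subrr.
split=> [p|M].
  exists setT; first exact: filterT.
  exists (2 * n%:R); split=> [|M nM [p1 p2] _ /=]; first exact: num_real.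
  rewrite /opt_K opprB addrA subrK; apply: le_trans (ler_dist_dist _ _) _.
  rewrite opprB addrA subrK -mulrBr normrM ger0_norm//.
  apply: (@le_trans _ _ (2 * n%:R * `|p1 - p2|)); last by rewrite ler_wpM2r// ltW.
  rewrite -mulrA ler_pM2l//; apply: le_trans (ler_dist_enorm _ _) _.
  exact: enorm_le_norm.
exists (`|M| + 2) => p Mp; have := ler_norm (2 * enorm p - 1).
by rewrite /opt_K; have := ler_norm M; have := normr_ge0 M; lra.
Qed.

(** At [x = 0] any unit vector serves, here the first basis vector; positive dimension enters the
    argument through this choice. *)
Lemma unit_direction x : (0 < n)%N -> exists2 e, enorm e = 1 & x = enorm x *: e.
Proof.
move=> n_gt0; have [->|x0] := eqVneq x 0; last first.
  have ex0 : enorm x != 0 by rewrite enorm_eq0.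
  exists ((enorm x)^-1 *: x); last by rewrite scalerA divff ?scale1r.
  by rewrite enormZ normfV (ger0_norm (enorm_ge0 x)) mulVf.
exists (delta_mx 0 (Ordinal n_gt0)); last by rewrite enorm0 scale0r.
rewrite enormE /dot (bigD1 (Ordinal n_gt0))//= mxE !eqxx mulr1 big1 ?addr0 ?sqrtr1//.
by move=> i i0; rewrite mxE (negbTE i0) andbF mulr0.
Qed.

Lemma dot_unit x e : enorm e = 1 -> x = enorm x *: e -> dot x e = enorm x.
Proof. by move=> e1 xE; rewrite {1}xE dotZl -sqr_enorm e1 expr1n mulr1. Qed.

Definition opt_u (k : R) x : R := expR ((enorm x - k) / 2).

Lemma opt_u_BUC (k : R) (A : set 'rV[R]_n) :
  (forall x, A x -> enorm x <= k) -> BUC A (opt_u k).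
Proof.
move=> Ak; apply: (BUC_lipschitz _ _ 1 2^-1) => // [x /Ak xk|x y /Ak xk /Ak yk].
  by rewrite ger0_norm ?expR_ge0// -expR0 ler_expR; lra.
(* The exponential is 1-Lipschitz on the negative half-line:
   [exp b - exp a = exp b (1 - exp (a - b))], with [exp b <= 1] and [exp (a - b) >= 1 + a - b]. *)
have expB (a b : R) : a <= b -> b <= 0 -> `|expR b - expR a| <= b - a.
  move=> ab b0; rewrite ger0_norm ?subr_ge0 ?ler_expR//.
  have -> : expR a = expR b * expR (a - b) by rewrite -expRD subrKC.
  have := expR_ge1Dx (a - b); have : expR b <= 1 by rewrite -expR0 ler_expR.
  have := expR_gt0 b; nra.
have d := ler_dist_enorm x y; rewrite mulrC ler_pdivlMr//.
have [xy|/ltW yx] := leP (enorm x) (enorm y).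
  rewrite distrC; have := expB ((enorm x - k) / 2) ((enorm y - k) / 2).
  by move: d; rewrite ler0_norm ?subr_le0// /opt_u; lra.
have := expB ((enorm y - k) / 2) ((enorm x - k) / 2).
by move: d; rewrite ger0_norm ?subr_ge0// /opt_u; lra.
Qed.

Lemma is_derive_expR_affine (k r s : R) :
  is_derive (0 : R) (1 : R) (fun h => expR ((r + s * h - k) / 2))
    (s * (expR ((r - k) / 2) / 2)).
Proof.
have hs : is_derive (0 : R) (1 : R) ( *%R s) s.
  by have := is_deriveZ s (is_derive_id (0 : R) (1 : R)); rewrite [_ *: _]mulr1.
have ha := is_derive_affine (k - r) 2 (s * 0).
have he := is_derive_expR ((s * 0 - (k - r)) / 2).
have := @is_derive1_comp R expR ((fun t => (t - (k - r)) / 2) \o ( *%R s))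
  0 _ _ he (is_derive1_comp ha hs).
rewrite mulr0 sub0r opprB.
rewrite (_ : _ * (2^-1 * s) = s * (expR ((r - k) / 2) / 2)); last by ring.
rewrite (_ : expR \o _ = fun h => expR ((r + s * h - k) / 2))//.
apply/funext => t /=; congr (expR (_ / 2)); ring.
Qed.


Lemma opt_u_line (k : R) x v h : enorm v = 1 ->
  opt_u k (h *: v + x) <= expR ((enorm x + `|h| - k) / 2).
Proof.
move=> v1; rewrite ler_expR ler_pM2r// lerD2r addrC.
by apply: le_trans (enormD _ _) _; rewrite enormZ v1 mulr1 addrC.
Qed.

(** If [phi] touches from above at [x] with gradient [p], then [2 |p|] equals [opt_u k x], which is
    at most 1. Hence [|p| <= 1/2], on which range [opt_H x p = - 2 |p|], and the equation holds with
    equality. *)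
Lemma opt_u_subsolution (k : R) : (0 < n)%N ->
  viscosity_subsolution opt_H (eball k) (opt_u k).
Proof.
move=> n_gt0; split; first by apply: opt_u_BUC => x /ltW.
move=> x phi xk C1phi umax; have [dphi _] := C1phi x xk.
set p := grad phi x.
have near_max v : \forall h \near (0 : R)^'+,
    opt_u k (h *: v + x) - opt_u k x <= phi (h *: v + x) - phi x.
  apply: (near_line x v (fun y => opt_u k y - opt_u k x <= phi y - phi x)).
  have nk : \forall y \near x, eball k y.
    by apply: open_nbhs_nbhs; split=> //; exact: open_eball.
  apply: (@filterS2 _ (nbhs x) _ _ _ _ _ umax nk) => y /[apply]; lra.
have u1 : opt_u k x <= 1 by rewrite -expR0 ler_expR; move: xk; rewrite /eball/=; lra.
(* Move radially outward from [x]: there [opt_u] grows at rate [opt_u k x / 2], and [phi] must grow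
   at least as fast. *)
have up : opt_u k x <= 2 * enorm p.
  have [e e1 xE] := unit_direction x n_gt0.
  have h := ler_derive_right _ _ _ _ (is_derive_expR_affine k (enorm x) 1)
    (is_derive_line phi x e dphi).
  have : 1 * (expR ((enorm x - k) / 2) / 2) <= dot p e.
    apply: h; near=> h.
    have h0 : 0 < h by near: h; exact: nbhs_right_gt.
    have : opt_u k (h *: e + x) - opt_u k x <= phi (h *: e + x) - phi x.
      by near: h; exact: near_max.
    have -> : opt_u k (h *: e + x) = expR ((enorm x + 1 * h - k) / 2).
      rewrite /opt_u {1}xE -scalerDl enormZ e1 mulr1 mul1r.
      by rewrite ger0_norm ?addr_ge0 ?enorm_ge0 ?(ltW h0)// (addrC h).
    by rewrite scale0r add0r mulr0 addr0.
  have := dot_le p e; rewrite e1 mulr1 /opt_u; lra.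
(* Move against [p]: since [|x - h e| >= |x| - h], [opt_u] falls at rate at most [opt_u k x / 2],
   and so does [phi], whose rate of descent is [|p|]. *)
have pu : 2 * enorm p <= opt_u k x.
  have [e e1 pE] := unit_direction p n_gt0.
  have h := ler_derive_right _ _ _ _ (is_derive_expR_affine k (enorm x) (-1))
    (is_derive_line phi x (- e) dphi).
  have : -1 * (expR ((enorm x - k) / 2) / 2) <= dot p (- e).
    apply: h; near=> h.
    have h0 : 0 < h by near: h; exact: nbhs_right_gt.
    have : opt_u k (h *: - e + x) - opt_u k x <= phi (h *: - e + x) - phi x.
      by near: h; exact: near_max.
    have : expR ((enorm x + -1 * h - k) / 2) <= opt_u k (h *: - e + x).
      rewrite ler_expR ler_pM2r// lerD2r.
      have := enormD (h *: - e + x) (h *: e).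
      by rewrite scalerN addrAC addNr add0r enormZ e1 (gtr0_norm h0); lra.
    by rewrite scale0r add0r mulr0 addr0 /opt_u; lra.
  by rewrite -(scaleN1r e) dotZr dot_unit// /opt_u; lra.
by rewrite opt_H_small -/p; lra.
Unshelve. all: by end_near. Qed.

Lemma opt_u_supersolution (k : R) : (0 < n)%N ->
  viscosity_supersolution opt_H (eball k) (opt_u k).
Proof.
move=> n_gt0; split; first by apply: opt_u_BUC; exact: closure_eball_le.
move=> x phi xk [U [_ kU C1phi]] umin; have [dphi _] := C1phi x (kU x xk).
(* On the sphere [opt_u >= 1] balances the minimum [- 1] of [opt_H]. Inside, moving along [p] gives
   [2 |p| <= opt_u k x], because the norm grows at rate at most 1. *)
set p := grad phi x; have [kx|{}xk] := leP k (enorm x).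
  have : 1 <= opt_u k x by rewrite -expR0 ler_expR; lra.
  by have := opt_H_ge_cst x p; lra.
suff : 2 * enorm p <= opt_u k x by have := opt_H_ge_linear x p; lra.
have [e e1 pE] := unit_direction p n_gt0.
have := ler_derive_right _ _ _ _ (is_derive_line phi x e dphi)
  (is_derive_expR_affine k (enorm x) 1).
rewrite dot_unit// => h.
suff : enorm p <= 1 * (expR ((enorm x - k) / 2) / 2) by rewrite /opt_u; lra.
apply: h; near=> h.
have h0 : 0 < h by near: h; exact: nbhs_right_gt.
have : phi (h *: e + x) - phi x <= opt_u k (h *: e + x) - opt_u k x.
  near: h; apply: (near_line x e
    (fun y => phi y - phi x <= opt_u k y - opt_u k x)).
  have nk : \forall y \near x, eball k y.
    by apply: open_nbhs_nbhs; split=> //; exact: open_eball.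
  apply: (@filterS2 _ (nbhs x) _ _ _ _ _ umin nk) => y h /subset_closure/h; lra.
have := opt_u_line k x e h e1; rewrite (gtr0_norm h0) mul1r.
by rewrite scale0r add0r mulr0 addr0 /opt_u; lra.
Unshelve. all: by end_near. Qed.

(** With [e] the direction of [x], the plane exponential [exp ((e . y - k) / 2)] agrees with
    [opt_u k] at [x]. On the closed ball it is at most 1, so its gradient has norm at most 1/2 and
    it solves the equation classically; it can be used in [supersolution_ge_test]. *)
Lemma opt_u_le_supersolution (k : R) (v : 'rV[R]_n -> R) : (0 < n)%N ->
  viscosity_supersolution opt_H (eball k) v ->
  forall x, closure (eball k) x -> opt_u k x <= v x.
Proof.
move=> n_gt0 vsup x xk; have [e e1 xE] := unit_direction x n_gt0.
have [C1d gd] := @C1_on_dot R n e; have [C1w gw] := C1_on_exp k 2 _ C1d.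
have := supersolution_ge_test _ _ _ _ vsup C1w.
rewrite /opt_u -(dot_unit x e e1 xE) dotC; apply => // y /closure_eball_le yk.
have w0 := expR_gt0 ((dot e y - k) / 2).
have -> : opt_H y (grad (fun x => expR ((dot e x - k) / 2)) y) =
    - expR ((dot e y - k) / 2).
  have wE : 2 * enorm (grad (fun x => expR ((dot e x - k) / 2)) y) =
      expR ((dot e y - k) / 2).
    by rewrite gw gd enormZ e1 gtr0_norm ?divr_gt0//; lra.
  rewrite opt_H_small wE// -[leRHS]expR0 ler_expR.
  by have := dot_le e y; rewrite e1 mul1r; lra.
by rewrite subrr.
Qed.

End optimality.


(** * Merging of the constants, and the theorem *)

(** Absorbs prefactor and decay length into one constant: as [s - k <= 0], enlarging [M] to [C] only
    increases [exp ((s - k) / M)]. *)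
Lemma expR_rate_le (R : realType) (B C M s k : R) : 0 < M -> M <= C -> B <= C ->
  s <= k ->
  B * expR (s / M) * expR (- (k / M)) <= C * expR (s / C) * expR (- (k / C)).
Proof.
move=> M0 MC BC sk; have C0 : 0 < C := lt_le_trans M0 MC.
rewrite -!mulrA -!expRD -!mulNr -!mulrDl.
apply: (@le_trans _ _ (C * expR ((s - k) / M))).
  by rewrite ler_wpM2r ?expR_ge0.
rewrite ler_pM2l// ler_expR; apply: ler_wnM2l; first by rewrite subr_le0.
by rewrite lef_pV2 ?posrE.
Qed.

Theorem theorem1p2 (R : realType) (n : nat) (n_gt0 : (0 < n)%N) :
  (forall H : 'rV[R]_n -> 'rV[R]_n -> R, separable_hamiltonian H ->
    (forall u, state_constraint_solution H setT u -> forall x, u x = 0) /\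
    exists C : R,
      [/\ 0 < C,
          forall (k : nat) (u_k : 'rV[R]_n -> R), (0 < k)%N ->
            state_constraint_solution H (eball k%:R) u_k ->
            forall x, closure (eball k%:R) x ->
              0 <= u_k x <= (C * expR (enorm x / C)) * expR (- (k%:R / C))
        & forall (r : R) (k : nat) (u_k : 'rV[R]_n -> R), 0 < r ->
            (0 < k)%N -> r <= k%:R ->
            state_constraint_solution H (eball k%:R) u_k ->
            forall x, closure (eball r) x ->
              0 <= u_k x <= (C * expR (r / C)) * expR (- (k%:R / C))])
  /\
  (exists H : 'rV[R]_n -> 'rV[R]_n -> R, separable_hamiltonian H /\
    exists c C : R,
      [/\ 0 < c, 0 < C
        & forall k : nat, (0 < k)%N ->
            (exists u_k, state_constraint_solution H (eball k%:R) u_k) /\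
            (forall u_k, state_constraint_solution H (eball k%:R) u_k ->
              forall x, closure (eball k%:R) x ->
                (c * expR (enorm x / C)) * expR (- (k%:R / C)) <= u_k x
                  <= (C * expR (enorm x / C)) * expR (- (k%:R / C)))]).
Proof.
split=> [H sH|].
  split; first by move=> u; exact: whole_space_solution_eq0.
  have [H0 [d [L [d0 L0 HL]]] [A A0 HA]] := separable_estimates H sH.
  (* [M] is the slope of the linear lower bound on [H], and [A * expR M^-1] the prefactor of the
     barrier estimate. Both come from [H] alone, so [C] is fixed before [k] and [u_k]. *)
  pose M := Num.max L (A / d); pose C := Num.max M (A * expR M^-1).
  have M0 : 0 < M by rewrite lt_max L0.
  have MC : M <= C by rewrite le_max lexx.
  have BC : A * expR M^-1 <= C by rewrite le_max lexx orbT.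
  have C0 : 0 < C := lt_le_trans M0 MC.
  have bound (k : nat) u_k : state_constraint_solution H (eball k%:R) u_k ->
      forall x, closure (eball k%:R) x ->
      0 <= u_k x <= (C * expR (enorm x / C)) * expR (- (k%:R / C)).
    move=> [usub usup] x xk; apply/andP; split.
      exact: (supersolution_ge0 H k%:R).
    apply: le_trans (expR_rate_le _ _ _ _ _ _ M0 MC BC
      (closure_eball_le _ _ xk)).
    apply: (subsolution_le_exp H A M k%:R) => //.
      exact: linear_lower_bound.
    exact: BUC_continuous usup.1.
  exists C; split=> // [k u_k _|r k u_k r0 _ rk /bound uk x xr]; first exact: bound.
  have xk : closure (eball k%:R) x.
    by apply: closure_subset xr => y yr; exact: lt_le_trans yr rk.
  have /andP[-> /le_trans] := uk x xk; apply.
  rewrite ler_pM2r ?expR_gt0// ler_pM2l// ler_expR ler_pM2r ?invr_gt0//.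
  exact: closure_eball_le.
exists opt_H; split; first exact: opt_H_separable.
(* The explicit solution is [exp ((|x| - k) / 2)], so [c = 1] and decay length 2 are exact for the
   lower bound. *)
exists 1, 2; split=> // k _; split.
  exists (opt_u k%:R); split; first exact: opt_u_subsolution.
  exact: opt_u_supersolution.
move=> u_k [usub usup] x xk; apply/andP; split.
  apply: le_trans (opt_u_le_supersolution k%:R u_k n_gt0 usup x xk).
  by rewrite mul1r -expRD -mulNr -mulrDl.
apply: le_trans (expR_rate_le _ (1 * expR 2^-1) _ 2 _ _ _ _ _
  (closure_eball_le _ _ xk)) => //.
  apply: subsolution_le_exp usub _ _ xk => //.
  - exact: opt_H_ge_cst.
  - exact: opt_H_ge_linear.
  exact: BUC_continuous usup.1.
(* The barrier prefactor [exp (1/2)] must be at most 2, which follows from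
   [exp (- 1/2) >= 1 - 1/2]. *)
have := expR_ge1Dx (- 2^-1 : R); rewrite expRN mul1r.
have e0 := expR_gt0 (2^-1 : R).
by rewrite -(ler_pM2r e0) mulVf ?gt_eqF//; lra.
Qed.
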